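(* Let $d\ge 2$. Every Misiurewicz point $c_0\in\mathbb{C}$ of the family $f_{d,c}(z)=z^d+c$ is an algebraic integer.
   Context: $f^n$ denotes the $n$-th iterate. A point $z_0$ has period $(m,n)$ for $f$ if $f^{m+n}(z_0)=f^m(z_0)$; it has exact period $(m,n)$ if in addition it does not have period $(k,t)$ for any $k\le m$ and $t\mid n$ with at least one of $k<m$ or $t<n$. A parameter $c_0$ is a Misiurewicz point of period $(m,n)$ if the critical point $0$ has exact period $(m,n)$ for $f_{d,c_0}$ and $m>0$; it is a Misiurewicz point if this holds for some $m\ge1$, $n\ge1$. *)

(* Defs.v *)
From mathcomp Require Import all_boot all_order all_algebra.
From mathcomp Require Import complex.
From mathcomp Require Import reals.

Set Implicit Arguments.
Unset Strict Implicit.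
Unset Printing Implicit Defensive.

Import GRing.Theory Num.Theory.
Local Open Scope ring_scope.

Definition has_period (T : Type) (f : T -> T) (z : T) (m n : nat) : Prop :=
  iter (m + n) f z = iter m f z.

Definition has_exact_period (T : Type) (f : T -> T) (z : T) (m n : nat) : Prop :=
  has_period f z m n /\
  forall k t : nat, (k <= m)%N -> (t %| n)%N -> (k < m)%N || (t < n)%N ->
    ~ has_period f z k t.

Definition unicritical (K : nzRingType) (d : nat) (c : K) : K -> K :=
  fun z => z ^+ d + c.

Definition misiurewicz_of_period (K : nzRingType) (d : nat) (c : K)
    (m n : nat) : Prop :=
  (0 < m)%N /\ has_exact_period (unicritical d c) 0 m n.

Definition misiurewicz (K : nzRingType) (d : nat) (c : K) : Prop :=
  exists m n : nat,
    [/\ (1 <= m)%N, (1 <= n)%N & misiurewicz_of_period d c m n].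

Definition algebraic_integer (K : nzRingType) (z : K) : Prop :=
  integralOver (intmul 1 : int -> K) z.

(* Main.v *)
Require Import Defs.
From mathcomp Require Import all_boot all_order all_algebra.
From mathcomp Require Import complex.
From mathcomp Require Import reals.

(** The critical orbit of the family, computed for the generic parameter ['X]
    over the integers, consists of polynomials [P_k]
    with [P_0 = 0] and [P_(k+1) = P_k ^+ d + 'X].  Specializing ['X] to [c]
    gives the orbit of 0 under [z ^+ d + c], so a preperiodic critical orbit
    makes [c] a root of [P_(m+n) - P_m].  Each [P_k] with [k > 0] is monic, and
    the degrees increase strictly with [k] because [d >= 2]; hence for [n > 0]
    the leading term of [P_(m+n)] is not cancelled by [P_m], and the difference
    is a monic integer polynomial vanishing at [c]. *)

Import GRing.Theory.
Local Open Scope ring_scope.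

(** Taking the parameter to be the indeterminate itself makes the polynomials an
    instance of the very family under study. *)
Definition critical_poly (d k : nat) : {poly int} :=
  iter k (unicritical d 'X) 0.

Lemma critical_polyS (d k : nat) :
  critical_poly d k.+1 = critical_poly d k ^+ d + 'X.
Proof. by []. Qed.

Lemma horner_critical_poly (K : comNzRingType) (d k : nat) (c : K) :
  (map_poly (intmul 1) (critical_poly d k)).[c] = iter k (unicritical d c) 0.
Proof.
elim: k => [|k IHk]; first by rewrite /critical_poly /= rmorph0 horner0.
by rewrite critical_polyS rmorphD rmorphXn /= map_polyX hornerD horner_exp
  hornerX IHk.
Qed.

(** Once the degree is positive, raising to a power [d >= 2] raises it strictly
    and beyond that of ['X], so ['X] does not disturb the leading term. *)
Lemma monic_expDX (d : nat) (p : {poly int}) :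
  (2 <= d)%N -> p \is monic -> (1 < size p)%N ->
  p ^+ d + 'X \is monic /\ (size p < size (p ^+ d + 'X)%R)%N.
Proof.
move=> d_ge2 p_monic p_gt1.
have lt_p : (size p < size (p ^+ d))%N.
  have := size_exp p d; have := monic_neq0 (monic_exp d p_monic).
  rewrite -size_poly_gt0; case: (size p) p_gt1 => [|[|s]] //= _.
  case: (size (p ^+ d)) => //= t _ ->.
  by rewrite ltnS -[X in (X < _)%N]muln1 ltn_pmul2l.
have lt_X : (size ('X : {poly int}) < size (p ^+ d))%N.
  by rewrite size_polyX; apply: leq_ltn_trans lt_p.
split; last by rewrite size_polyDl.
by rewrite monicE lead_coefDl // -monicE monic_exp.
Qed.

Lemma critical_poly_monic_gt1 (d k : nat) :
  (2 <= d)%N ->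
  critical_poly d k.+1 \is monic /\ (1 < size (critical_poly d k.+1))%N.
Proof.
move=> d_ge2; elim: k => [|k [k_monic k_gt1]].
  rewrite critical_polyS /critical_poly /= expr0n.
  by case: d d_ge2 => // d _; rewrite add0r monicX size_polyX.
rewrite critical_polyS; have [-> lt_k] := monic_expDX _ _ d_ge2 k_monic k_gt1.
by split=> //; apply: ltn_trans lt_k.
Qed.

Lemma size_critical_polyS (d k : nat) :
  (2 <= d)%N ->
  (size (critical_poly d k) < size (critical_poly d k.+1))%N.
Proof.
move=> d_ge2; case: k => [|k].
  have [_ gt1] := critical_poly_monic_gt1 _ 0 d_ge2.
  by rewrite (_ : critical_poly d 0 = 0) // size_poly0 (ltn_trans _ gt1).
have [k_monic k_gt1] := critical_poly_monic_gt1 _ k d_ge2.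
by have [] := monic_expDX _ _ d_ge2 k_monic k_gt1.
Qed.

Lemma preperiodic_parameter_integral
    (K : comNzRingType) (d : nat) (c : K) (m n : nat) :
  (2 <= d)%N -> (0 < n)%N ->
  has_period (unicritical d c) 0 m n -> algebraic_integer c.
Proof.
move=> d_ge2 n_gt0 per_c.
have lt_size : (size (- critical_poly d m) < size (critical_poly d (m + n)))%N.
  rewrite size_polyN; case: n n_gt0 {per_c} => // n _.
  elim: n => [|n IHn]; first by rewrite addn1 size_critical_polyS.
  by rewrite addnS (ltn_trans IHn) ?size_critical_polyS.
exists (critical_poly d (m + n) - critical_poly d m).
  rewrite monicE lead_coefDl // -monicE.
  case: n n_gt0 {per_c lt_size} => // n _.
  by rewrite addnS; have [] := critical_poly_monic_gt1 _ (m + n) d_ge2.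
by rewrite /root rmorphB hornerD hornerN /= !horner_critical_poly per_c subrr.
Qed.

Theorem corollary3p4 (R : realType) (d : nat) (hd : (2 <= d)%N) (c0 : R[i])
    (hc0 : misiurewicz d c0) : algebraic_integer c0.
Proof.
have [m [n [_ n_gt0 [_ [per_c0 _]]]]] := hc0.
exact: preperiodic_parameter_integral _ _ _ _ _ hd n_gt0 per_c0.
Qed.
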